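(* Let $\mathbf{X}\in\mathbb{R}^{p\times n}$ be a deterministic matrix whose columns have unit Euclidean norm, and let $\mathbf{Y}=\mathbf{H}\mathbf{D}\mathbf{X}$, where $\mathbf{H}\in\mathbb{R}^{p\times p}$ is either an (orthonormal) Hadamard matrix or an (orthonormal) DCT matrix and $\mathbf{D}\in\mathbb{R}^{p\times p}$ is a random diagonal matrix whose diagonal entries are independent and uniform on $\{\pm1\}$. Let $\eta=1$ if $\mathbf{H}$ is a Hadamard matrix and $\eta=1/2$ if $\mathbf{H}$ is a DCT matrix. Let $m\ge1$ be an integer with $m/p\le 0.5$, let $t>0$, and let $$\delta_1=2p\exp\left(\frac{-nt^2/2}{\left(\frac pm-1\right)\|\mathbf{Y}\|_{\text{max-row}}^2/n+\tau(m,p)\|\mathbf{Y}\|_{\max}\,t/3}\right),\qquad \tau(m,p)=\max\Big\{\frac pm-1,\,1\Big\}.$$ Then, with probability greater than $0.99$ (over $\mathbf{D}$), $$\delta_1\le2p\exp\left(\frac{-mnt^2}{\frac4\eta\log(200np)\left(1+\sqrt p\,t/3\right)}\right),$$ and thus (whenever this holds) $\delta_1\le0.001$ provided that $$m\ge\frac1n\cdot\frac4\eta\log(200np)\log(2000p)\left(t^{-2}+\frac{\sqrt p\,t^{-1}}3\right).$$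
   Context: $\|\mathbf{Y}\|_{\max}$ is the maximum absolute value of the entries of $\mathbf{Y}$; $\|\mathbf{Y}\|_{\text{max-row}}$ is the maximum $\ell_2$ norm of its rows. A Hadamard matrix here is normalized to be orthonormal, so its entries are $\pm1/\sqrt p$ (it is assumed to exist for the given $p$); the DCT matrix is the orthonormal discrete cosine transform matrix, whose entries are bounded in absolute value by $\sqrt{2/p}$. The quantity $\delta_1$ is the failure probability (conditional on $\mathbf{D}$) in the guarantee $\|\widehat{\overline{\mathbf{y}}}_n-\overline{\mathbf{y}}_n\|_\infty\le t$, where $\overline{\mathbf{y}}_n$ is the mean of the columns $\mathbf{y}_i$ of $\mathbf{Y}$ and $\widehat{\overline{\mathbf{y}}}_n=\frac pm\frac1n\sum_i\mathbf{R}_i\mathbf{R}_i^T\mathbf{y}_i$ is the estimator obtained by keeping, independently for each $i$, $m$ of the $p$ entries of $\mathbf{y}_i$ chosen uniformly at random without replacement. *)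

(* Defs.v *)
From HB Require Import structures.
From mathcomp Require Import all_boot all_order all_algebra.
From mathcomp Require Import all_classical all_reals all_analysis.

Set Implicit Arguments.
Unset Strict Implicit.
Unset Printing Implicit Defensive.

Import Order.TTheory GRing.Theory Num.Theory.
Import numFieldNormedType.Exports.

Local Open Scope classical_set_scope.
Local Open Scope ring_scope.

Definition norm2 {R : realType} {p : nat} (v : 'cV[R]_p) : R :=
  Num.sqrt (\sum_(i < p) v i 0 ^+ 2).

(* [mx_norm] is the library's entrywise sup norm. *)
Definition max_norm {R : realType} {p n : nat} (Y : 'M[R]_(p, n)) : R :=
  mx_norm Y.

Definition max_row_norm {R : realType} {p n : nat} (Y : 'M[R]_(p, n)) : R :=
  \big[Num.max/0]_(i < p) norm2 (row i Y)^T.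

Definition is_hadamard {R : realType} {p : nat} (H : 'M[R]_p) : Prop :=
  (forall i j, H i j = (Num.sqrt p%:R)^-1 \/ H i j = - (Num.sqrt p%:R)^-1) /\
  H *m H^T = 1%:M.

(* Orthonormal DCT of type II: row [i] is the frequency, column [j] the time. *)
Definition dct_mx (R : realType) (p : nat) : 'M[R]_p :=
  \matrix_(i < p, j < p)
    (Num.sqrt ((if val i == 0%N then 1 else 2) / p%:R) *
     cos (pi * (2 * j%:R + 1) * i%:R / (2 * p%:R))).

Definition mutually_independent {d : measure_display} {T : measurableType d}
    {R : realType} (P : probability T R) {I : finType}
    (X : I -> {RV P >-> R}) : Prop :=
  forall (J : {set I}) (B : I -> set R),
    (forall i, i \in J -> measurable (B i)) ->
    P (\bigcap_(i in [set` J]) (X i @^-1` B i)) =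
    (\prod_(i in J) P (X i @^-1` B i))%E.

Definition uniform_sign {d : measure_display} {T : measurableType d}
    {R : realType} (P : probability T R) (X : {RV P >-> R}) : Prop :=
  P (X @^-1` [set 1]) = (2^-1)%:E /\ P (X @^-1` [set -1]) = (2^-1)%:E.

(* Value at the sample point [w] of the random diagonal matrix with diagonal
   entries [eps i]. *)
Definition rdiag {d : measure_display} {T : measurableType d}
    {R : realType} {P : probability T R} {p : nat}
    (eps : 'I_p -> {RV P >-> R}) (w : T) : 'M[R]_p :=
  diag_mx (\row_(i < p) eps i w).

Definition tau (R : realType) (m p : nat) : R :=
  Num.max (p%:R / m%:R - 1) 1.

Definition delta1 {R : realType} {p n : nat} (m : nat) (t : R)
    (Y : 'M[R]_(p, n)) : R :=
  2 * p%:R *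
  expR (- (n%:R * t ^+ 2 / 2) /
        ((p%:R / m%:R - 1) * max_row_norm Y ^+ 2 / n%:R
         + tau R m p * max_norm Y * t / 3)).

Definition delta1_bound {R : realType} (p n m : nat) (eta t : R) : R :=
  2 * p%:R *
  expR (- (m%:R * n%:R * t ^+ 2) /
        (4 / eta * ln (200 * n%:R * p%:R) * (1 + Num.sqrt p%:R * t / 3))).

(* Main.v *)
(* Each entry of Y is a Rademacher sum whose coefficients [H i k * X k j] have
   squares adding up to at most [1 / (eta p)], so by Chernoff's bound and a union
   bound over the np entries, [max |Y i j| <= M] with
   [M^2 = 2 log(200np) / (eta p)] fails with probability less than 1/100.
   When it holds, the row norms are at most [sqrt n * M], and the bound on
   delta_1 follows because [sqrt p * M = sqrt (2 log(200np) / eta)] is at most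
   its square. Almost surely D is one of 2^p equiprobable sign patterns, so the
   probability can be computed by counting patterns. The quotient in delta_1 takes
   the junk value 0 when Y = 0, so H has to be shown injective, which for the DCT
   means proving orthonormality. *)
Require Import Defs.
From HB Require Import structures.
From mathcomp Require Import all_boot all_order all_algebra.
From mathcomp Require Import all_classical all_reals all_analysis.
From mathcomp Require Import measurable_realfun ring lra.

Import Order.TTheory GRing.Theory Num.Theory.
Import numFieldNormedType.Exports.

Local Open Scope classical_set_scope.
Local Open Scope ring_scope.

(** * Sub-Gaussian tails of Rademacher sums, by counting sign patterns *)

Lemma le_is_derive_le0 (R : realType) (f df : R -> R) (x : R) :
  (forall y, is_derive y (1 : R) f (df y)) -> (forall y, 0 < y -> df y <= 0) ->
  0 <= x -> f x <= f 0.
Proof.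
move=> fdf df_le0; rewrite le_eqVlt => /predU1P[<-//|x_gt0].
have cf : {within `[0, x], continuous f}.
  apply: continuous_subspaceT => y.
  by apply/differentiable_continuous/derivable1_diffP; have [] := fdf y.
have [c /[!in_itv]/= /andP[c_gt0 _] fE] := MVT x_gt0 (fun y _ => fdf y) cf.
by rewrite -subr_le0 fE mulr_le0_ge0 ?df_le0// subr_ge0 ltW.
Qed.

(* [2 cosh x <= 2 exp (x^2 / 2)]: the quotient [g] of the two sides, up to the
   factor 2, is nonincreasing on [0, +oo[, its derivative having the sign of
   [k]. *)
Lemma expRDN_le_gauss (R : realType) (x : R) :
  expR x + expR (- x) <= 2 * expR (x ^+ 2 / 2).
Proof.
wlog x_ge0 : x / 0 <= x.
  move=> H; have [/H//|/ltW x_le0] := leP 0 x.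
  by rewrite addrC -sqrrN -{2}[x]opprK H ?oppr_ge0.
pose k (y : R) := (1 - y) * expR y - (1 + y) * expR (- y).
have k_le0 (y : R) : 0 < y -> k y <= 0.
  move=> y_gt0.
  have <- : k 0 = 0 by rewrite /k oppr0 subrr.
  apply: (@le_is_derive_le0 _ k (fun z => z * (expR (- z) - expR z))).
  - by move=> z; apply: is_derive_eq; rewrite /GRing.scale/=; ring.
  - move=> z z_gt0; rewrite pmulr_rle0// subr_le0 ler_expR; lra.
  - exact: ltW.
pose g (y : R) := expR (y - y ^+ 2 / 2) + expR (- y - y ^+ 2 / 2).
have gE y : g y = (expR y + expR (- y)) * expR (- (y ^+ 2 / 2)).
  by rewrite /g !expRD mulrDl.
have : g x <= g 0.
  apply: (@le_is_derive_le0 _ g (fun z => k z * expR (- (z ^+ 2 / 2)))) => //.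
  - by move=> z; apply: is_derive_eq; rewrite /GRing.scale/= /k !expRD; field.
  - by move=> z z_gt0; rewrite mulr_le0_ge0 ?expR_ge0 ?k_le0.
rewrite gE (expRN (x ^+ 2 / 2)) ler_pdivrMr ?expR_gt0//.
by rewrite /g expr0n/= mul0r !oppr0 !addr0 expR0 -[1 + 1]/2.
Qed.

(** By distributivity, the sum over all patterns of a product over [k] is the product over [k] of
    sums over two signs. Each factor is [2 cosh (a k)], to which [expRDN_le_gauss] applies. *)
Lemma rademacher_mgf_le (R : realType) (I : finType) (a : I -> R) :
  \sum_(f : {ffun I -> bool}) expR (\sum_k a k * (-1) ^+ f k) <=
  2 ^+ #|I| * expR ((\sum_k a k ^+ 2) / 2).
Proof.
under eq_bigr do rewrite expR_sum.
rewrite -(bigA_distr_bigA (fun k b => expR (a k * (-1) ^+ nat_of_bool b))).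
rewrite mulr_suml expR_sum.
rewrite -[#|I|]sum1_card -prodrXr -big_split/=.
apply: ler_prod => k _; rewrite big_bool/= expr1 expr0 mulrN1 mulr1.
by rewrite addr_ge0 ?expR_ge0//= addrC expr1 expRDN_le_gauss.
Qed.

(** Chernoff's method for both tails at once: a pattern with [|S f| > s] contributes more than
    [exp (l s)] to the sum of [exp (l S) + exp (- l S)]. Every other pattern still contributes a
    positive amount, so the inequality is strict; this yields a probability strictly above 99/100 in
    the end. *)
Lemma rademacher_tail (R : realType) (I : finType) (a : I -> R) (v s : R) :
  0 < v -> 0 <= s -> \sum_k a k ^+ 2 <= v ->
  #|[set f : {ffun I -> bool} | s < `|\sum_k a k * (-1) ^+ f k|]%SET|%:R <
  2 ^+ #|I| * (2 * expR (- (s ^+ 2 / (2 * v)))).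
Proof.
move=> v_gt0 s_ge0 av.
set S := fun f : {ffun I -> bool} => \sum_k a k * (-1) ^+ f k.
set B := [set f | _]%SET.
(* This [l] minimises the Chernoff exponent [l ^+ 2 * v / 2 - l * s]. *)
pose l := s / v.
have l_ge0 : 0 <= l by rewrite divr_ge0// ltW.
rewrite -(ltr_pM2r (expR_gt0 (l * s))).
have -> : 2 ^+ #|I| * (2 * expR (- (s ^+ 2 / (2 * v)))) * expR (l * s) =
    2 * (2 ^+ #|I| * expR (l ^+ 2 * v / 2)).
  rewrite -!mulrA -expRD mulrCA; congr (_ * (_ * expR _)).
  by rewrite /l; field; rewrite lt0r_neq0.
apply: (@lt_le_trans _ _
    (\sum_f (expR (l * S f) + expR (- l * S f)))).
  rewrite -sum1_card natr_sum mulr_suml big_mkcond/=.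
  (* A strict comparison of sums needs a nonempty index set. *)
  pose f0 : {ffun I -> bool} := [ffun=> true].
  apply: ltr_sum; first by apply/hasP; exists f0; rewrite ?mem_index_enum.
  move=> f _; rewrite inE -/(S f); case: ifPn => [sS|_]; last first.
    by rewrite addr_gt0 ?expR_gt0.
  rewrite mul1r; have [S_ge0|S_lt0] := leP 0 (S f).
    rewrite ger0_norm// in sS.
    by rewrite ltr_pwDr ?expR_gt0// ler_expR ler_wpM2l// ltW.
  rewrite ltr0_norm// in sS.
  by rewrite ltr_pwDl ?expR_gt0// ler_expR mulNr -mulrN ler_wpM2l// ltW.
have mgf c : c ^+ 2 = l ^+ 2 ->
    \sum_f expR (c * S f) <= 2 ^+ #|I| * expR (l ^+ 2 * v / 2).
  move=> cl; under eq_bigr do rewrite /S mulr_sumr.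
  under eq_bigr do under eq_bigr do rewrite mulrA.
  have := rademacher_mgf_le _ _ (fun k => c * a k); move/le_trans; apply.
  rewrite ler_wpM2l ?exprn_ge0// ler_expR ler_wpM2r ?invr_ge0//.
  under eq_bigr do rewrite exprMn cl.
  by rewrite -mulr_sumr ler_wpM2l ?sqr_ge0.
by rewrite big_split/= mulr2n mulrDl mul1r lerD// mgf// sqrrN.
Qed.

(** * Orthonormality of the DCT matrix *)

(* Telescopes: [2 sin a cos ((2j+1) a) = sin ((2j+2) a) - sin (2j a)]. *)
Lemma sum_cos_odd (R : realType) (p : nat) (a : R) :
  2 * sin a * \sum_(j < p) cos ((2 * j%:R + 1) * a) = sin (2 * p%:R * a).
Proof.
elim: p => [|p IHp]; first by rewrite big_ord0 !mulr0 mul0r sin0.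
rewrite big_ord_recr/= mulrDr IHp.
have -> : 2 * p%:R * a = (2 * p%:R + 1) * a - a by ring.
have -> : 2 * p.+1%:R * a = (2 * p%:R + 1) * a + a by rewrite -natr1; ring.
rewrite sinB sinD; ring.
Qed.

(** With [a = k pi / (2p)], the telescoped sum is [sin (k pi) = 0]. The bounds on [k] place [a]
    strictly between 0 and [pi], so the factor [sin a] can be cancelled. *)
Lemma sum_cos_dct (R : realType) (p k : nat) : (0 < k)%N -> (k < 2 * p)%N ->
  \sum_(j < p) cos (pi * (2 * j%:R + 1) * k%:R / (2 * p%:R)) = 0 :> R.
Proof.
move=> k_gt0 k_lt.
have p_gt0 : 0 < p%:R :> R by rewrite ltr0n; case: (p) k_lt.
pose a : R := pi * k%:R / (2 * p%:R).
have sa : 0 < sin a.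
  apply: sin_gt0_pi; apply/andP; split.
    by rewrite /a divr_gt0 ?mulr_gt0 ?pi_gt0 ?p_gt0 ?ltr0n.
  by rewrite /a ltr_pdivrMr ?mulr_gt0// ltr_pM2l ?pi_gt0// -natrM ltr_nat.
have : 2 * sin a * \sum_(j < p) cos ((2 * j%:R + 1) * a) = 0.
  rewrite sum_cos_odd.
  have -> : 2 * p%:R * a = 0 + pi *+ k.
    by rewrite add0r -mulr_natr /a; field; rewrite lt0r_neq0.
  rewrite -[RHS]sin0; elim: (k) => [|j IHj]; first by rewrite mulr0n addr0.
  by rewrite mulrSr addrA sinDpi IHj sin0 oppr0.
move/eqP; rewrite mulf_eq0 mulf_eq0 pnatr_eq0/= (gt_eqF sa)/=.
move=> /eqP; apply: etrans.
by apply: eq_bigr => j _; congr cos; rewrite /a; ring.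
Qed.

(** The product-to-sum formula turns the inner product of rows [i] and [j] into cosine sums of
    frequencies [i - j] and [i + j], which vanish unless the frequency is 0. *)
Lemma dct_mx_orthogonal (R : realType) (p : nat) :
  dct_mx R p *m (dct_mx R p)^T = 1%:M.
Proof.
pose C (k : nat) (j : 'I_p) : R :=
  cos (pi * (2 * j%:R + 1) * k%:R / (2 * p%:R)).
have CC i j k : (j <= i)%N ->
    C i k * C j k = (C (i - j)%N k + C (i + j)%N k) / 2.
  move=> ji; rewrite /C natrB// natrD.
  rewrite (mulrBr (pi * _)) (mulrDr (pi * _)) mulrBl mulrDl cosB cosD.
  by field.
have C0 k : C 0%N k = 1 by rewrite /C mulr0 mul0r cos0.
apply/matrixP => i j; rewrite !mxE.
wlog ji : i j / (j <= i)%N.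
  move=> H; case/orP: (leq_total j i) => [|/H]; first exact: H.
  by rewrite eq_sym => <-; apply: eq_bigr => k _; rewrite !mxE mulrC.
have p_gt0 : 0 < p%:R :> R by rewrite ltr0n; case: (p) i {j ji} => [[]|].
have lt2p : (i + j < 2 * p)%N by rewrite mul2n -addnn -addSn leq_add// ltnW.
under eq_bigr => k _ do rewrite !mxE -/(C _ _) -/(C _ _) mulrACA CC//.
rewrite -mulr_sumr -mulr_suml big_split/=.
have [<-|ij] := eqVneq i j.
  rewrite subnn (eq_bigr (fun=> 1))// sumr_const card_ord.
  rewrite -expr2 sqr_sqrtr ?divr_ge0 ?ltW//; last by case: ifP.
  (* In row 0 both cosine sums equal [p]; in any other row only the one of frequency 0 survives. The
     scaling by 1 or 2 in [dct_mx] compensates for this. *)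
  have [i0|i_gt0] := posnP i.
    rewrite i0 (eq_bigr (fun=> 1))// sumr_const card_ord.
    by rewrite mulr1n; field; rewrite lt0r_neq0.
  rewrite sum_cos_dct ?addn_gt0 ?i_gt0//; last first.
    by rewrite mul2n -addnn -addSn leq_add// ltnW.
  by rewrite mulr1n; field; rewrite lt0r_neq0.
have jlti : (j < i)%N by rewrite ltn_neqAle ji andbT eq_sym.
rewrite !sum_cos_dct ?addr0 ?mul0r ?mulr0//.
- by rewrite addn_gt0 (leq_ltn_trans _ jlti).
- by rewrite subn_gt0.
- by rewrite (leq_ltn_trans (leq_subr _ _))// (leq_ltn_trans (leq_addr j _)).
Qed.

(** * Deterministic bounds on [delta1] *)

Lemma max_norm_ge0 (R : realType) (p n : nat) (Y : 'M[R]_(p, n)) :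
  0 <= max_norm Y.
Proof. by rewrite /max_norm mx_normrE bigmax_ge_id. Qed.

Lemma le_max_norm (R : realType) (p n : nat) (Y : 'M[R]_(p, n)) i j :
  `|Y i j| <= max_norm Y.
Proof. by rewrite /max_norm mx_normrE (le_bigmax _ _ (i, j)). Qed.

Lemma max_norm_le (R : realType) (p n : nat) (Y : 'M[R]_(p, n)) (M : R) :
  0 <= M -> (forall i j, `|Y i j| <= M) -> max_norm Y <= M.
Proof. by move=> M0 YM; rewrite /max_norm mx_normrE; apply: bigmax_le. Qed.

Lemma max_row_norm_ge0 (R : realType) (p n : nat) (Y : 'M[R]_(p, n)) :
  0 <= max_row_norm Y.
Proof. exact: bigmax_ge_id. Qed.

Lemma max_row_norm_le (R : realType) (p n : nat) (Y : 'M[R]_(p, n)) :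
  max_row_norm Y ^+ 2 <= n%:R * max_norm Y ^+ 2.
Proof.
have Y0 := max_norm_ge0 _ _ _ Y.
suff : max_row_norm Y <= Num.sqrt (n%:R * max_norm Y ^+ 2).
  rewrite -ler_sqr ?nnegrE ?sqrtr_ge0 ?max_row_norm_ge0//.
  by rewrite sqr_sqrtr// mulr_ge0 ?sqr_ge0.
apply: bigmax_le => [|i _]; first exact: sqrtr_ge0.
rewrite ler_wsqrtr// -[n in n%:R]card_ord mulr_natl -sumr_const.
apply: ler_sum => j _; rewrite !mxE -real_normK ?num_real//.
by rewrite lerXn2r ?nnegrE ?le_max_norm.
Qed.

(** It suffices that [e <= 4]. From [1 + y <= exp y] at [y = -1/2] one gets [exp (1/2) <= 2], and
    squaring concludes. *)
Lemma ln_ge1 (R : realType) (x : R) : 4 <= x -> 1 <= ln x.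
Proof.
move=> x4; have x0 : 0 < x by lra.
rewrite -ler_expR lnK ?posrE// (le_trans _ x4)//.
have e0 : 0 < expR (2^-1 : R) by exact: expR_gt0.
have e2 : expR (2^-1 : R) <= 2.
  have := expR_ge1Dx (- 2^-1 : R); rewrite expRN => h.
  by rewrite -lef_pV2 ?posrE//; lra.
have -> : (1 : R) = 2^-1 + 2^-1 by lra.
rewrite expRD; nra.
Qed.

Lemma delta1_le_bound (R : realType) (p n m : nat) (eta t : R)
    (Y : 'M[R]_(p, n)) :
  (0 < p)%N -> (0 < n)%N -> (0 < m)%N -> m%:R / p%:R <= 1 / 2 :> R ->
  0 < t -> 0 < eta <= 1 -> Y != 0 ->
  max_norm Y <= Num.sqrt (2 * ln (200 * n%:R * p%:R) / (eta * p%:R)) ->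
  delta1 m t Y <= delta1_bound p n m eta t.
Proof.
rewrite -!(ltr0n R) => p_gt0 n_gt0 m_gt0 mp t_gt0 /andP[eta_gt0 eta_le1] Y_neq0.
set L := ln _; set M := Num.sqrt _ => YM.
have np_ge1 : 1 <= n%:R * p%:R :> R.
  by rewrite -natrM ler1n muln_gt0 -!(ltr0n R) n_gt0.
have L_ge1 : 1 <= L by apply: ln_ge1; lra.
(* This is what makes the denominator [den] of [delta1] positive. *)
have nu_gt0 : 0 < max_norm Y.
  rewrite lt_def max_norm_ge0 andbT; apply: contra_neq Y_neq0.
  exact: mx_norm_eq0.
set nu := max_norm Y in YM nu_gt0 *.
have M_gt0 : 0 < M by exact: lt_le_trans YM.
pose q : R := Num.sqrt p%:R; pose K := 2 * L / eta.
have q_gt0 : 0 < q by rewrite sqrtr_gt0.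
have K_ge1 : 1 <= K by rewrite ler_pdivlMr//; lra.
have qM2 : (q * M) ^+ 2 = K.
  rewrite exprMn /q /M !sqr_sqrtr ?ltW// /K; last first.
    by rewrite divr_gt0 ?mulr_gt0//; lra.
  by field; rewrite !lt0r_neq0.
(* Since [K >= 1], which uses [eta <= 1], also [q * M >= 1], so [q * M] is at most its square
   [K]. *)
have qM_le : q * M <= K.
  have qM_ge1 : 1 <= q * M.
    have qM_ge0 : 0 <= q * M by rewrite mulr_ge0 ?ltW.
    by rewrite -(@ler_pXn2r _ 2)// ?nnegrE// expr1n qM2.
  by rewrite -qM2 expr2 ler_peMl// (le_trans _ qM_ge1).
pose a : R := p%:R / m%:R.
have a_ge2 : 2 <= a.
  rewrite ler_pdivlMr//; move: mp; rewrite ler_pdivrMr//; lra.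
rewrite /delta1 /delta1_bound -/L -/q -/nu /tau -/a.
(* The assumption [m / p <= 1/2] means [a >= 2]. Both terms of [den] then share the factor [a - 1],
   which is relaxed to [a] below. *)
have -> : Num.max (a - 1) 1 = a - 1 by apply/max_idPl; lra.
set den := (X in - _ / X); set C := (X in _ <= _ * expR (_ / X)).
have row_le : max_row_norm Y ^+ 2 / n%:R <= nu ^+ 2.
  by rewrite ler_pdivrMr// mulrC max_row_norm_le.
have row_ge0 : 0 <= max_row_norm Y ^+ 2 / n%:R.
  by rewrite divr_ge0 ?sqr_ge0 ?ltW.
have den_gt0 : 0 < den.
  rewrite /den ltr_wpDl ?divr_gt0 ?mulr_gt0//; last by lra.
  by rewrite -mulrA mulr_ge0//; lra.
have C_gt0 : 0 < C.
  have qt_gt0 : 0 < q * t by rewrite mulr_gt0.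
  rewrite /C mulr_gt0//; last by lra.
  by rewrite mulr_gt0 ?divr_gt0//; lra.
have a1_ge0 : 0 <= a - 1 by lra.
have a1_le : a - 1 <= a by lra.
have den_le : den <= a * (M ^+ 2 + M * t / 3).
  have nuM2 : nu ^+ 2 <= M ^+ 2.
    by rewrite ler_pXn2r ?nnegrE ?(ltW nu_gt0) ?(ltW M_gt0).
  have nuMt : nu * t / 3 <= M * t / 3 by rewrite ler_pM2r// ler_pM2r.
  have nut_ge0 : 0 <= nu * t / 3 by rewrite divr_ge0// mulr_ge0 ?ltW.
  rewrite /den -mulrA -(mulrA (a - 1) nu) -(mulrA (a - 1)) -mulrDr.
  apply: ler_pM => //; first exact: addr_ge0.
  by apply: lerD => //; exact: le_trans row_le nuM2.
(* As [m * a = q ^+ 2], the left side is at most [2 (q M)^2 + 2 q (q M) t / 3], while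
   [C = 2 K + 2 q K t / 3]: the first terms agree and [qM_le] compares the second ones. *)
have mdenC : 2 * m%:R * den <= C.
  apply: (@le_trans _ _ (2 * m%:R * (a * (M ^+ 2 + M * t / 3)))).
    by rewrite ler_pM2l// mulr_gt0.
  have -> : 2 * m%:R * (a * (M ^+ 2 + M * t / 3)) =
            2 * (q * M) ^+ 2 + 2 * q * (q * M) * t / 3.
    have -> : a = q ^+ 2 / m%:R by rewrite /a /q sqr_sqrtr// ltW.
    by field; rewrite lt0r_neq0.
  rewrite qM2; have -> : C = 2 * K + 2 * q * K * t / 3.
    by rewrite /C /K; field; rewrite lt0r_neq0.
  rewrite lerD2l -!(mulrA (2 * q)) !mulrA -!(mulrA (2 * q)).
  by rewrite ler_pM2l ?mulr_gt0// !ler_pM2r.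
rewrite ler_pM2l ?mulr_gt0// ler_expR !mulNr lerN2.
rewrite ler_pdivrMr// [leRHS]mulrAC ler_pdivlMr//.
have -> : m%:R * n%:R * t ^+ 2 * den =
    n%:R * t ^+ 2 / 2 * (2 * m%:R * den) by field.
by rewrite ler_wpM2l// divr_ge0// mulr_ge0 ?sqr_ge0 ?ltW.
Qed.

(** Multiplied by [n t^2], the condition on [m] reads [C * ln (2000 p) <= m n t^2]. The exponential
    is then at most [1 / (2000 p)], and the prefactor [2 p] leaves 1/1000. *)
Lemma delta1_bound_le (R : realType) (p n m : nat) (eta t : R) :
  (0 < p)%N -> (0 < n)%N -> 0 < t -> 0 < eta ->
  n%:R^-1 * (4 / eta * ln (200 * n%:R * p%:R) * ln (2000 * p%:R)
             * (t ^- 2 + Num.sqrt p%:R * t^-1 / 3)) <= m%:R ->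
  delta1_bound p n m eta t <= 1 / 1000.
Proof.
rewrite -!(ltr0n R) => p_gt0 n_gt0 t_gt0 eta_gt0.
set L := ln (_ * _ * _); set q := Num.sqrt _ => m_ge.
have np_ge1 : 1 <= n%:R * p%:R :> R.
  by rewrite -natrM ler1n muln_gt0 -!(ltr0n R) n_gt0.
have L_ge1 : 1 <= L by apply: ln_ge1; lra.
have q_gt0 : 0 < q by rewrite sqrtr_gt0.
rewrite /delta1_bound -/L -/q; set C := (X in expR (_ / X)).
have C_gt0 : 0 < C.
  have qt_gt0 : 0 < q * t by rewrite mulr_gt0.
  rewrite /C mulr_gt0//; last by lra.
  by rewrite mulr_gt0 ?divr_gt0//; lra.
have p2000 : 0 < 2000 * p%:R :> R by lra.
apply: (@le_trans _ _ (2 * p%:R * expR (- ln (2000 * p%:R)))); last first.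
  rewrite expRN lnK ?posrE// le_eqVlt; apply/orP; left; apply/eqP.
  by field; rewrite lt0r_neq0.
rewrite ler_pM2l ?mulr_gt0// ler_expR mulNr lerN2 ler_pdivlMr//.
have nt_gt0 : 0 < n%:R * t ^+ 2 by rewrite mulr_gt0 ?exprn_gt0.
rewrite -(ler_pM2r nt_gt0) in m_ge.
rewrite -[m%:R * n%:R * _]mulrA (le_trans _ m_ge)// le_eqVlt.
apply/orP; left; apply/eqP.
by rewrite /C; field; rewrite !lt0r_neq0.
Qed.

(** * Measurability of [delta1] *)

Lemma measurable_bigmax d (T : measurableType d) (R : realType) (I : Type)
    (r : seq I) (x : R) (h : I -> T -> R) :
  (forall i, measurable_fun setT (h i)) ->
  measurable_fun setT (fun w => \big[Num.max/x]_(i <- r) h i w).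
Proof.
move=> mh; elim: r => [|i r IHr].
  by under eq_fun do rewrite big_nil; exact: measurable_cst.
by under eq_fun do rewrite big_cons; exact: measurable_maxr.
Qed.

Lemma measurable_funV d (T : measurableType d) (R : realType) (f : T -> R) :
  measurable_fun setT f -> measurable_fun setT (fun w => (f w)^-1).
Proof.
(* The power has a nonnegative base, and both sides vanish where [f] does. *)
move=> mf; rewrite (_ : (fun w => _) = fun w => f w * (f w ^+ 2) `^ (-1)).
  apply: measurable_funM => //.
  apply: (measurableT_comp (measurable_powR _)).
  exact: (measurable_funX _ mf).
apply/funext => w; rewrite powR_inv1 ?sqr_ge0// expr2 invfM.
by have [->|fw0] := eqVneq (f w) 0; rewrite ?invr0 ?mul0r// mulVKf.
Qed.

Lemma measurable_delta1 d (T : measurableType d) (R : realType) (p n m : nat)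
    (t : R) (Y : T -> 'M[R]_(p, n)) :
  (forall i j, measurable_fun setT (fun w => Y w i j)) ->
  measurable_fun setT (fun w => delta1 m t (Y w)).
Proof.
move=> mY.
have mmax : measurable_fun setT (fun w => max_norm (Y w)).
  rewrite /max_norm; under eq_fun do rewrite mx_normrE.
  by apply: measurable_bigmax => ij; exact: measurableT_comp.
have mrow : measurable_fun setT (fun w => max_row_norm (Y w)).
  apply: measurable_bigmax => i.
  rewrite /norm2; apply: (@measurableT_comp _ _ _ _ _ _ (@Num.sqrt R)).
    by apply: continuous_measurable_fun; exact: sqrt_continuous.
  apply: measurable_sum => j; apply: measurable_funX.
  by under eq_fun do rewrite !mxE; exact: mY.
apply: measurable_funM => //; apply: measurableT_comp => //.
apply: measurable_funM => //; apply: measurable_funV.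
apply: measurable_funD; apply: measurable_funM => //.
  by apply: measurable_funM => //; exact: measurable_funX.
by apply: measurable_funM => //; exact: measurable_funM.
Qed.

(** * From counting sign patterns to probabilities *)

Lemma sign_pattern_prob d (T : measurableType d) (R : realType)
    (P : probability T R) (I : finType) (eps : I -> {RV P >-> R})
    (f : {ffun I -> bool}) :
  (forall i, uniform_sign (eps i)) -> mutually_independent eps ->
  P [set w | forall i, eps i w = (-1) ^+ f i] = (2^-1 ^+ #|I|)%:E.
Proof.
move=> unif indep.
have -> : [set w | forall i, eps i w = (-1) ^+ f i] =
    \bigcap_(i in [set` [set: I]%SET]) eps i @^-1` [set (-1) ^+ f i].
  by apply/seteqP; split => w /= W i => [_|]; apply: W; rewrite //= inE.
rewrite indep => [|i _]; last exact: measurable_set1.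
rewrite (eq_bigr (fun=> (2^-1)%:E)) => [|i _]; last first.
  by have [P1 PN1] := unif i; case: (f i); rewrite ?expr0 ?expr1.
by rewrite -(big_morph EFin (@EFinM R) (erefl 1%:E)) prodr_const cardsT.
Qed.

(** The events of the patterns in [G] are disjoint, equiprobable and contained in [E]. A lower bound
    suffices, so sample points where some [eps i] is not a sign can be ignored. *)
Lemma prob_ge_sign_patterns d (T : measurableType d) (R : realType)
    (P : probability T R) (I : finType) (eps : I -> {RV P >-> R})
    (G : {set {ffun I -> bool}}) (E : set T) :
  (forall i, uniform_sign (eps i)) -> mutually_independent eps ->
  measurable E ->
  (forall f w, f \in G -> (forall i, eps i w = (-1) ^+ f i) -> E w) ->
  ((#|G|%:R / 2 ^+ #|I|)%:E <= P E)%E.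
Proof.
move=> unif indep mE GE.
pose A (f : {ffun I -> bool}) := [set w | forall i, eps i w = (-1) ^+ f i].
have mA f : measurable (A f).
  have -> : A f = \bigcap_(i in [set: I]) eps i @^-1` [set (-1) ^+ f i].
    by apply/seteqP; split => w /= W i => [_|]; exact: W.
  exact: fin_bigcap_measurable.
have tA : trivIset [set` enum G] A.
  move=> f g _ _ [w [Af Ag]]; apply/ffunP => i.
  (* Two patterns differing at [i] would give [1 = -1]. *)
  have := Af i; rewrite Ag; case: (f i) (g i) => [] [] //;
    rewrite ?expr0 ?expr1; lra.
rewrite (_ : (_%:E) = P (\bigcup_(f in [set` enum G]) A f)).
  apply: le_measure; rewrite ?inE//.
    by apply: fin_bigcup_measurable => // f _; exact: mA.
  by move=> w [f /= fG Afw]; apply: (GE f); rewrite // -mem_enum.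
rewrite measure_fin_bigcup//= -fsbig_seq ?enum_uniq//.
rewrite (eq_bigr (fun=> (2^-1 ^+ #|I|)%:E)) => [|f _]; last first.
  exact: sign_pattern_prob.
rewrite sumEFin big_enum/= sumr_const.
by rewrite exprVn mulr_natl.
Qed.

Lemma rademacher_union_tail (R : realType) (I J : finType) (a : J -> I -> R)
    (v s : R) :
  (0 < #|J|)%N -> 0 < v -> 0 <= s -> (forall j, \sum_k a j k ^+ 2 <= v) ->
  #|[set f : {ffun I -> bool} |
      [exists j, s < `|\sum_k a j k * (-1) ^+ f k|]]%SET|%:R <
  #|J|%:R * (2 ^+ #|I| * (2 * expR (- (s ^+ 2 / (2 * v))))).
Proof.
move=> J_gt0 v_gt0 s_ge0 av; set B := [set f | _]%SET.
pose Bj j := [set f : {ffun I -> bool} | s < `|\sum_k a j k * (-1) ^+ f k|]%SET.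
have /le_lt_trans : #|B|%:R <= \sum_j #|Bj j|%:R :> R.
  rewrite -natr_sum ler_nat -sum1_card.
  under [leqRHS]eq_bigr do rewrite -sum1_card big_mkcond.
  rewrite exchange_big/= big_mkcond/=; apply: leq_sum => f _.
  case: ifPn => //; rewrite inE => /existsP[j sj].
  by rewrite (bigD1 j)//= inE sj.
apply; rewrite -sum1_card natr_sum mulr_suml; apply: ltr_sum.
  by case/card_gt0P: J_gt0 => j _; apply/hasP; exists j; rewrite ?mem_index_enum.
by move=> j _; rewrite mul1r; exact: rademacher_tail.
Qed.

(** * Entries of [H], and the random event *)

Lemma hadamard_sqr (R : realType) (p : nat) (H : 'M[R]_p) i j :
  is_hadamard H -> H i j ^+ 2 = p%:R^-1.
Proof.
by move=> [+ _] => /(_ i j) [] ->; rewrite ?sqrrN exprVn sqr_sqrtr.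
Qed.

Lemma dct_mx_sqr_le (R : realType) (p : nat) i j :
  dct_mx R p i j ^+ 2 <= 2 / p%:R.
Proof.
rewrite mxE exprMn sqr_sqrtr; last by rewrite divr_ge0//; case: ifP.
rewrite -[leRHS]mulr1 ler_pM ?sqr_ge0//.
- by rewrite divr_ge0//; case: ifP.
- by rewrite ler_wpM2r ?invr_ge0//; case: ifP => // _; rewrite ler1n.
Qed.

Lemma rdiag_mulE d (T : measurableType d) (R : realType) (P : probability T R)
    (p n : nat) (eps : 'I_p -> {RV P >-> R}) (H : 'M[R]_p) (X : 'M[R]_(p, n))
    w i j :
  (H *m rdiag eps w *m X) i j = \sum_k H i k * X k j * eps k w.
Proof.
rewrite -mulmxA mxE; apply: eq_bigr => k _.
by rewrite mul_diag_mx !mxE; ring.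
Qed.

Theorem corollary5 (R : realType) (d : measure_display) (T : measurableType d)
    (P : probability T R) (p n m : nat) (X : 'M[R]_(p, n)) (H : 'M[R]_p)
    (eta t : R) (eps : 'I_p -> {RV P >-> R})
    (p_gt0 : (0 < p)%N) (n_gt0 : (0 < n)%N)
    (X_unit : forall j : 'I_n, norm2 (col j X) = 1)
    (H_eta : (is_hadamard H /\ eta = 1) \/ (H = dct_mx R p /\ eta = 1 / 2))
    (eps_sign : forall i : 'I_p, uniform_sign (eps i))
    (eps_indep : mutually_independent eps)
    (m_ge1 : (1 <= m)%N) (m_le : m%:R / p%:R <= 1 / 2 :> R) (t_gt0 : 0 < t) :
  let Y (w : T) : 'M[R]_(p, n) := H *m rdiag eps w *m X in
  let E : set T := [set w | delta1 m t (Y w) <= delta1_bound p n m eta t] in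
  [/\ measurable E,
      ((99 / 100)%:E < P E)%E &
      n%:R^-1 * (4 / eta * ln (200 * n%:R * p%:R) * ln (2000 * p%:R)
                 * (t ^- 2 + Num.sqrt p%:R * t^-1 / 3)) <= m%:R ->
      forall w : T, E w -> delta1 m t (Y w) <= 1 / 1000].
Proof.
move=> Y E.
have eta_bounds : 0 < eta <= 1 by case: H_eta => -[_ ->]; lra.
have /andP[eta_gt0 _] := eta_bounds.
have pR_gt0 : 0 < p%:R :> R by rewrite ltr0n.
have nR_gt0 : 0 < n%:R :> R by rewrite ltr0n.
have H_orth : H *m H^T = 1%:M.
  by case: H_eta => [[[]]//|[-> _]]; exact: dct_mx_orthogonal.
(* Common bound on the squared entries: [1 / p] for Hadamard, [2 / p] for DCT. As the columns of [X]
   have unit norm, it also bounds the variance of each entry of [Y]. *)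
pose v : R := (eta * p%:R)^-1.
have v_gt0 : 0 < v by rewrite invr_gt0 mulr_gt0.
have H_sqr i j : H i j ^+ 2 <= v.
  case: H_eta => -[hH etaE]; rewrite /v etaE.
    by rewrite hadamard_sqr// mul1r.
  by rewrite hH (le_trans (dct_mx_sqr_le _ _ _ _))// mul1r invfM invrK.
have X_sqr j : \sum_k X k j ^+ 2 = 1.
  have := X_unit j; rewrite /norm2; under eq_bigr do rewrite mxE.
  move=> /(congr1 (fun x => x ^+ 2)); rewrite sqr_sqrtr ?expr1n//.
  by apply: sumr_ge0 => k _; exact: sqr_ge0.
have mE : measurable E.
  rewrite -[E]setTI; apply: measurable_fun_le => //.
  apply: measurable_delta1 => i j; rewrite /Y.
  under eq_fun do rewrite rdiag_mulE.
  by apply: measurable_sum => k; exact: measurable_funM.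
split=> //; last first.
  move=> m_ge w Ew; apply: le_trans Ew _.
  exact: delta1_bound_le.
pose L : R := ln (200 * n%:R * p%:R).
pose M : R := Num.sqrt (2 * L / (eta * p%:R)).
pose a (ij : 'I_p * 'I_n) (k : 'I_p) := H ij.1 k * X k ij.2.
pose B := [set f : {ffun 'I_p -> bool} |
             [exists ij, M < `|\sum_k a ij k * (-1) ^+ f k|]]%SET.
have np_ge1 : 1 <= n%:R * p%:R :> R by rewrite -natrM ler1n muln_gt0 n_gt0.
have L_gt0 : 0 < L by apply: (@lt_le_trans _ _ 1) => //; apply: ln_ge1; lra.
have B_lt : #|B|%:R < 2 ^+ p / 100 :> R.
  have av ij : \sum_k a ij k ^+ 2 <= v.
    rewrite -[leRHS]mulr1 -(X_sqr ij.2) mulr_sumr; apply: ler_sum => k _.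
    by rewrite exprMn ler_wpM2r ?sqr_ge0.
  have := @rademacher_union_tail R _ _ a v M _ v_gt0 (sqrtr_ge0 _) av.
  rewrite !card_prod !card_ord muln_gt0 p_gt0 n_gt0.
  move=> /(_ isT) /lt_le_trans; apply.
  (* [M] is chosen for this identity: the union bound becomes [n p * 2^p * 2 exp (- L)], and
     [exp (- L) = 1 / (200 n p)] leaves [2^p / 100]. *)
  have -> : M ^+ 2 / (2 * v) = L.
    rewrite /M sqr_sqrtr; last first.
      by apply: divr_ge0; apply: mulr_ge0 => //; exact: ltW.
    by rewrite /v; field; rewrite !lt0r_neq0.
  rewrite expRN lnK ?posrE; last by lra.
  rewrite natrM le_eqVlt; apply/orP; left; apply/eqP.
  by field; rewrite !lt0r_neq0.
have good f w : f \in (~: B)%SET -> (forall i, eps i w = (-1) ^+ f i) -> E w.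
  rewrite !inE negb_exists => /forallP fB wf.
  have YE i j : Y w i j = \sum_k a (i, j) k * (-1) ^+ f k.
    by rewrite /Y rdiag_mulE; apply: eq_bigr => k _; rewrite wf.
  rewrite /E/=; apply: delta1_le_bound => //.
    (* If [Y = 0], cancelling [H] (its transpose is also a left inverse) and then the nonzero signs
       gives [X = 0], against its unit columns. *)
    apply/eqP => Y0.
    have DX0 : rdiag eps w *m X = 0.
      rewrite -[LHS]mul1mx -(mulmx1C H_orth) -mulmxA (mulmxA H).
      by rewrite -/(Y w) Y0 mulmx0.
    have X0 k j : X k j = 0.
      move/matrixP: DX0 => /(_ k j); rewrite mul_diag_mx !mxE wf => /eqP.
      by rewrite mulf_eq0 signr_eq0/= => /eqP.
    have := X_sqr (Ordinal n_gt0); under eq_bigr do rewrite X0 expr0n/=.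
    by rewrite big1// => /esym/eqP; rewrite oner_eq0.
  apply: max_norm_le => [|i j]; first exact: sqrtr_ge0.
  by rewrite YE leNgt; exact: (fB (i, j)).
apply: lt_le_trans
  (prob_ge_sign_patterns _ _ _ _ _ _ _ _ eps_sign eps_indep mE good).
rewrite lte_fin card_ord ltr_pdivlMr ?exprn_gt0//.
(* Fewer than [2^p / 100] bad patterns leave more than 99/100 of all patterns good. *)
have : #|B|%:R + #|~: B|%SET%:R = 2 ^+ p :> R.
  by rewrite -natrD cardsC card_ffun card_bool card_ord natrX.
lra.
Qed.
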